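(* Let $B_n$ be the Boolean lattice of subsets of $[n]=\{1,\dots,n\}$ ordered by inclusion, with its standard EL-labeling $\lambda(B,B\cup\{i\})=i$ for $B\subseteq [n]$, $i\in[n]\setminus B$. Then the map $m\mapsto\lambda(m)$ assigning to each maximal chain its label sequence is a poset isomorphism from the maximal chain descent order $(B_n)_\lambda(2)$ to the weak order on the symmetric group $S_n$ (the type A weak order).
   Context: For a finite poset $P$ with least element $\hat 0$ and greatest element $\hat 1$, $x\lessdot y$ denotes a cover relation and $\mathcal M(P)$ the set of maximal chains. For a chain $c$ and $x\in c$ write $c^x=\{w\in c: w\le x\}$, $c_x=\{w\in c: w\ge x\}$. An edge labeling $\lambda$ assigns to each cover relation a label in a poset $\Lambda$ (here the integers); a saturated chain gets the sequence of labels of its edges from bottom to top. A sequence is ascending if weakly increasing. $\lambda$ is an EL-labeling if for every $x<y$ the interval $[x,y]$ has a unique ascending maximal chain and this chain lexicographically precedes all other maximal chains of $[x,y]$. A saturated chain $u\lessdot v\lessdot w$ is a descent if $\lambda(u,v)\not\le\lambda(v,w)$. Polygon move: for $m,m'\in\mathcal M(P)$ write $m\to m'$ if there are $x<z$ in $m\cap m'$ with $m^x=m'^x$, $m_z=m'_z$, such that $m'\cap[x,z]$ is a descent $x\lessdot y\lessdot z$ with $y\notin m$, while $m\cap[x,z]$ is the unique ascending maximal chain of $[x,z]$. The maximal chain descent order $P_\lambda(2)$ is $\mathcal M(P)$ partially ordered by the reflexive and transitive closure of $\to$. Label sequences of maximal chains of $B_n$ are regarded as permutations of $[n]$ in one-line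 notation. The weak order on $S_n$ is the (right) weak order: $u\le_{wk}w$ iff $w=us_{i_1}\cdots s_{i_k}$ with $s_i=(i,i+1)$ and $\ell(us_{i_1}\cdots s_{i_j})=\ell(u)+j$ for all $1\le j\le k$, where $\ell$ is the number of inversions; right multiplication by $s_i$ swaps the entries in positions $i,i+1$. *)

(* Defs.v *)
From mathcomp Require Import all_boot all_order all_fingroup all_algebra.

Set Implicit Arguments.
Unset Strict Implicit.
Unset Printing Implicit Defensive.

Import Order.Theory.
Export Order.DefaultSetSubsetOrder.

Local Open Scope order_scope.

Section MaximalChainDescentOrder.

Context {d dL : Order.disp_t} {P : finTBPOrderType d} {L : porderType dL}.

Implicit Types (x y z w : P) (c m A : {set P}).

Definition covers x y : bool := (x < y) && [forall w, ~~ (x < w < y)].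

Definition itv x y : {set P} := [set w | x <= w <= y].

Definition is_chain c : bool := [forall x in c, forall y in c, x >=< y].

Definition maximal_chain A c : bool :=
  maxset [pred c' : {set P} | is_chain c' && (c' \subset A)] c.

Definition below c x : {set P} := [set w in c | w <= x].
Definition above c x : {set P} := [set w in c | x <= w].

(* An edge labeling is a total function [lam : P -> P -> L]; only its values
   on cover relations are ever used, since label sequences are only taken
   of saturated chains. *)
Implicit Type lam : P -> P -> L.

Definition label_seq lam c : seq L :=
  if sort <=%O (enum c) is x :: s then pairmap lam x s else [::].

Definition ascending lam c : bool := sorted <=%O (label_seq lam c).

Definition unique_ascending lam x y c : bool :=
  [&& maximal_chain (itv x y) c, ascending lam c &
    [forall c' : {set P},
      maximal_chain (itv x y) c' && ascending lam c' ==> (c' == c)]].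

(* [seqlexi L] is [seq L] with the lexicographic order. *)
Definition EL_labeling lam : Prop :=
  forall x y, x < y ->
  exists2 c, unique_ascending lam x y c &
    forall c', maximal_chain (itv x y) c' -> c' != c ->
      (label_seq lam c : seqlexi L) < (label_seq lam c' : seqlexi L).

Definition descent lam x y z : bool :=
  [&& covers x y, covers y z & ~~ (lam x y <= lam y z)].

Definition polygon_move lam m m' : bool :=
  [exists x, exists z,
    [&& x < z, x \in m :&: m', z \in m :&: m',
        below m x == below m' x, above m z == above m' z,
        [exists y, [&& m' :&: itv x z == [set x; y; z],
                       descent lam x y z & y \notin m]] &
        unique_ascending lam x z (m :&: itv x z)]].

End MaximalChainDescentOrder.

Definition maxchains d (P : finTBPOrderType d) : finType :=
  {m : {set P} | maximal_chain [set: P] m}.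

Definition mcd_le d dL (P : finTBPOrderType d) (L : porderType dL)
    (lam : P -> P -> L) (m m' : maxchains P) : Prop :=
  connect (fun c c' : maxchains P => polygon_move lam (val c) (val c')) m m'.

Definition partial_order (T : Type) (R : T -> T -> Prop) : Prop :=
  [/\ forall x, R x x,
      forall x y, R x y -> R y x -> x = y &
      forall x y z, R x y -> R y z -> R x z].

Definition poset_isomorphism (T U : Type) (leT : T -> T -> Prop)
    (leU : U -> U -> Prop) (f : T -> U) : Prop :=
  [/\ partial_order leT, partial_order leU, bijective f &
      forall x y, leT x y <-> leU (f x) (f y)].

(* The ground set {1, ..., n} is represented by ['I_n], the ordinal [i]
   standing for the integer [i.+1]; the Boolean lattice is [{set 'I_n}] with
   the inclusion order of [Order.DefaultSetSubsetOrder]. *)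
Definition boolean_label n (B C : {set 'I_n}) : int :=
  if [pick i in C :\: B] is Some i then Posz i.+1 else Posz 0.

Lemma boolean_labelE n (B : {set 'I_n}) (i : 'I_n) :
  i \notin B -> boolean_label B (i |: B) = Posz i.+1.
Proof.
move=> iB; rewrite /boolean_label; case: pickP => [j|/(_ i)].
  by rewrite !inE => /andP[jB]; rewrite (negPf jB) orbF => /eqP->.
by rewrite !inE eqxx iB.
Qed.

Definition one_line n (w : 'S_n) : seq int :=
  [seq Posz (w i).+1 | i <- enum 'I_n].

Definition inversions n (w : 'S_n) : nat :=
  #|[set p : 'I_n * 'I_n | (p.1 < p.2)%N && (w p.2 < w p.1)%N]|.

Lemma succ_ord_subproof n (i : 'I_n.-1) : (i.+1 < n)%N.
Proof. by rewrite -ltn_predRL. Qed.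

(* The transposition of the adjacent positions [i] and [i.+1]. *)
Definition simple_refl n (i : 'I_n.-1) : 'S_n :=
  tperm (widen_ord (leq_pred n) i) (Ordinal (succ_ord_subproof i)).

(* The product u s_(i_1) ... s_(i_k) of functions composed from right to left.
   In MathComp [(s * u) x = u (s x)], so right multiplication by s_i in the
   usual convention is left multiplication here: it swaps the entries of the
   one-line notation in positions [i] and [i.+1]. *)
Definition mul_word n (u : 'S_n) (s : seq 'I_n.-1) : 'S_n :=
  foldl (fun v i => (simple_refl i * v)%g) u s.

Definition weak_le n (u w : 'S_n) : Prop :=
  exists2 s : seq 'I_n.-1, w = mul_word u s &
    forall j, (0 < j <= size s)%N ->
      inversions (mul_word u (take j s)) = (inversions u + j)%N.

(* Main.v *)
Require Import Defs.
From mathcomp Require Import all_boot all_order all_fingroup all_algebra.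
From mathcomp Require Import zify.

(** A maximal chain of an interval [X, Y] of the Boolean lattice is the same
    thing as an ordering s of the elements of Y minus X: the chain adds these
    elements one at a time, and its label sequence is s itself
    ([flag_maximal], [maximal_flag], [label_seq_flag]).  This gives the EL
    property at once: the only ascending ordering is the increasing one, and it
    is lexicographically smallest among all rearrangements ([boolean_EL]).

    For the whole lattice the orderings are the permutations u, and the chain
    of u consists of the sets {u 0, ..., u (j - 1)}, one in each rank j.  In a
    polygon move the new chain differs from the old one in a single rank k + 1,
    so the two permutations differ by exchanging the entries in positions k and
    k + 1 ([initial_eq_simple_refl]); the old chain is ascending there and the
    new one has a descent, which means that u k < u (k + 1) before the exchange.
    Conversely every such exchange at an ascent is a polygon move, because an
    interval of rank two has just two maximal chains, the ascending one and the
    descent.  So polygon moves correspond to ascent steps of permutations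
    ([polygon_move_ascent], [ascent_polygon_move]).

    An adjacent exchange adds exactly one inversion at an ascent and removes one
    otherwise ([inversions_ascentE]), so the weak order is the reflexive and
    transitive closure of ascent steps ([weak_leP]).  The two orders are
    therefore closures of corresponding relations; antisymmetry holds on the
    permutation side because inversions strictly increase, and is carried back
    along the bijection. *)

Set Implicit Arguments.
Unset Strict Implicit.
Unset Printing Implicit Defensive.

Import Order.Theory.

(** * Chains in a finite poset *)

Section Chains.

Context {d : Order.disp_t} {P : finTBPOrderType d}.
Implicit Types (x y : P) (c A : {set P}).

Lemma is_chainP c : reflect {in c &, forall x y, (x >=< y)%O} (is_chain c).
Proof.
apply: (iffP forall_inP) => [h x y xc yc | h x xc].
  by have /forall_inP := h x xc; apply.
by apply/forall_inP => y yc; apply: h.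
Qed.

Lemma maximal_chainP A c :
  reflect ([/\ {in c &, forall x y, (x >=< y)%O}, c \subset A &
              forall c', {in c' &, forall x y, (x >=< y)%O} -> c' \subset A ->
                c \subset c' -> c' = c])
          (maximal_chain A c).
Proof.
apply: (iffP maxsetP) => /= [[/andP[/is_chainP chc cA] maxc]|[chc cA maxc]].
  split=> // c' chc' c'A cc'; apply: maxc => //.
  by apply/andP; split=> //; apply/is_chainP.
split; first by apply/andP; split=> //; apply/is_chainP.
by move=> c' /andP[/is_chainP chc' c'A] cc'; apply: maxc.
Qed.

Lemma maximal_chain_mem A c x : maximal_chain A c -> x \in A ->
  {in c, forall y, (x >=< y)%O} -> x \in c.
Proof.
case/maximal_chainP=> chc cA maxc xA xc.
rewrite -(maxc (x |: c)) ?setU11 ?subsetUr //; last first.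
  by rewrite subUset sub1set xA.
move=> y z /setU1P[->|yc] /setU1P[->|zc]; rewrite ?comparablexx ?xc //.
  by rewrite comparable_sym xc.
exact: chc.
Qed.

End Chains.

(** * Maximal chains of an interval of the subset lattice *)

Section Flags.

Variable T : finType.
Implicit Types (X Y Z W : {set T}) (s : seq T) (c : {set {set T}}).

Lemma le_subset X Y : (X <= Y)%O = (X \subset Y).
Proof. by []. Qed.

Lemma lt_proper X Y : (X < Y)%O = (X \proper Y).
Proof. by rewrite lt_neqAle properEneq. Qed.

Lemma itvE X Y Z : (Z \in itv X Y) = (X \subset Z) && (Z \subset Y).
Proof. by rewrite inE. Qed.

Lemma comparable_card_inj Z W : (Z >=< W)%O -> #|Z| = #|W| -> Z = W.
Proof.
by case/orP; rewrite le_subset => sub eqc; apply/eqP; [|rewrite eq_sym];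
  rewrite eqEcard sub eqc leqnn.
Qed.

Lemma covers_setU1 Y Z :
  covers Y Z -> exists2 i, i \notin Y & Z = i |: Y.
Proof.
case/andP=> + /forallP noW; rewrite lt_proper properE.
case/andP=> YZ /subsetPn[i iZ iY].
exists i => //; apply/eqP; rewrite eqEsubset subUset sub1set iZ YZ andbT.
have := noW (i |: Y); rewrite !lt_proper negb_and; case/orP.
  rewrite properE subsetUr /= negbK subUset sub1set (negPf iY) //.
by rewrite properE subUset sub1set iZ YZ /= negbK => ->.
Qed.

Lemma covers_setU1r Y i : i \notin Y -> covers Y (i |: Y).
Proof.
move=> iY; apply/andP; split.
  by rewrite lt_proper properE subsetUr subUset sub1set (negPf iY).
apply/forallP => W; rewrite !lt_proper; apply/negP.
case/andP=> /proper_card + /proper_card.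
by rewrite cardsU1 iY add1n ltnS => /leq_trans h /h; rewrite ltnn.
Qed.

(** A sequence rather than a set, because label sequences are read off the
    sorted enumeration of a chain, which is this sequence when no entry of s is
    repeated or already in X. *)
Definition flag X s : seq {set T} := X :: scanl (fun Z i => i |: Z) X s.

Lemma flag_cons X i s : flag X (i :: s) = X :: flag (i |: X) s.
Proof. by []. Qed.

(** The recursive form suits inductions on s; this one gives access to the
    k-th member. *)
Lemma flagE X s :
  flag X s = [seq X :|: [set:: take k s] | k <- iota 0 (size s).+1].
Proof.
elim: s X => [|i s IHs] X; first by rewrite /= set_nil setU0.
have -> : iota 0 (size (i :: s)).+1 = 0%N :: map S (iota 0 (size s).+1).
  by rewrite -[in RHS](iotaDl 1).
rewrite flag_cons IHs map_cons take0 set_nil setU0 -map_comp; congr (_ :: _).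
by apply: eq_map => k; rewrite /= set_cons setUA [i |: X]setUC.
Qed.

(** The hypothesis [perm_eq s (enum (Y :\: X))] says in one go that s is
    duplicate-free, avoids X and exhausts Y minus X; this is how it passes to the tail
    of s when X absorbs the head. *)
Lemma perm_enum_setD1 X Y i s : i \in Y :\: X ->
  perm_eq (i :: s) (enum (Y :\: X)) = perm_eq s (enum (Y :\: (i |: X))).
Proof.
move=> iYX; have := iYX; rewrite inE => /andP[iX iY].
suff /permPr-> : perm_eq (enum (Y :\: X)) (i :: enum (Y :\: (i |: X))).
  exact: perm_cons.
apply: uniq_perm; rewrite /= ?mem_enum ?enum_uniq ?andbT //.
  by rewrite !inE eqxx.
move=> j; rewrite !inE !mem_enum !inE.
by case: eqP => [->|]; rewrite ?iX ?iY.
Qed.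

Lemma perm_cons_setD X Y i s : perm_eq (i :: s) (enum (Y :\: X)) ->
  [/\ i \notin X, i \in Y & perm_eq s (enum (Y :\: (i |: X)))].
Proof.
move=> pe; have iYX : i \in Y :\: X.
  by rewrite -mem_enum -(perm_mem pe) mem_head.
by move: (iYX); rewrite inE => /andP[-> ->]; rewrite -perm_enum_setD1.
Qed.

Lemma flag_path X Y s : perm_eq s (enum (Y :\: X)) -> sorted <%O (flag X s).
Proof.
elim: s X => [//|i s IHs] X /perm_cons_setD[iX _ /IHs /= ->].
by rewrite andbT lt_proper properE subsetUr subUset sub1set (negPf iX).
Qed.

Lemma flag_itv X Y s Z : X \subset Y -> perm_eq s (enum (Y :\: X)) ->
  Z \in flag X s -> (X \subset Z) && (Z \subset Y).
Proof.
elim: s X => [|i s IHs] X XY pe.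
  by rewrite inE => /eqP->; rewrite subxx.
have [iX iY {}pe] := perm_cons_setD pe.
rewrite flag_cons inE => /predU1P[->|Zs]; first by rewrite subxx.
have iXY : i |: X \subset Y by rewrite subUset sub1set iY.
have := IHs _ iXY pe Zs.
by rewrite subUset => /andP[/andP[_ ->] ->].
Qed.

Lemma card_flag X Y s : perm_eq s (enum (Y :\: X)) ->
  [seq #|Z| | Z <- flag X s] = iota #|X| (size s).+1.
Proof.
elim: s X => [//|i s IHs] X /perm_cons_setD[iX _ /IHs].
by rewrite flag_cons map_cons cardsU1 iX => ->.
Qed.

Lemma flag_chain X Y s : perm_eq s (enum (Y :\: X)) ->
  {in [set:: flag X s] &, forall Z W, (Z >=< W)%O}.
Proof.
move=> pe Z W; rewrite !in_set => Zf Wf; move: Z W Zf Wf.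
have := flag_path pe; rewrite lt_sorted_pairwise.
elim: (flag X s) => //= Z l IHl.
case/andP=> /allP Zl /IHl{}IHl V W /predU1P[->|Vl] /predU1P[->|Wl].
- exact: comparablexx.
- by apply/orP; left; apply/ltW/Zl.
- by apply/orP; right; apply/ltW/Zl.
- exact: IHl.
Qed.

(** The members of a flag take all cardinalities from #|X| to #|Y|, so a set
    of the interval that is comparable to all of them has the cardinality of
    one of them, hence is that one. *)
Lemma flag_maximal X Y s : X \subset Y -> perm_eq s (enum (Y :\: X)) ->
  maximal_chain (itv X Y) [set:: flag X s].
Proof.
move=> XY pe; apply/maximal_chainP; split.
- exact: flag_chain pe.
- by apply/subsetP => Z; rewrite in_set itvE; apply: flag_itv.
move=> c chc cI fc; apply/eqP; rewrite eqEsubset fc andbT.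
apply/subsetP => Z Zc; have := subsetP cI Z Zc; rewrite itvE => /andP[XZ ZY].
have : #|Z| \in [seq #|W| | W <- flag X s].
  rewrite (card_flag pe) mem_iota (subset_leq_card XZ) addnS ltnS.
  rewrite (perm_size pe) -cardE cardsD (setIidPr XY).
  by rewrite subnKC subset_leq_card.
case/mapP=> W Wf eqc; rewrite in_set (_ : Z = W) //.
apply: comparable_card_inj eqc; apply: chc => //.
by apply: (subsetP fc); rewrite in_set.
Qed.

(** Induction on the size of Y minus X.  Let Z be the smallest member of c
    above X and i an element of Z outside X.  Then X with i added lies between
    X and Z, so it is comparable to every member of c and belongs to c by
    maximality; hence it is Z, and removing X from c leaves a maximal chain of
    [Z, Y]. *)
Lemma maximal_flag X Y c : X \subset Y -> maximal_chain (itv X Y) c ->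
  exists2 s, perm_eq s (enum (Y :\: X)) & c = [set:: flag X s].
Proof.
have [k] := ubnP #|Y :\: X|; elim: k X c => // k IHk X c ltk XY maxc.
have [chc cI maxc'] := maximal_chainP _ _ maxc.
have Xc : X \in c.
  apply: maximal_chain_mem maxc _ _; first by rewrite itvE subxx.
  move=> W /(subsetP cI); rewrite itvE => /andP[XW _].
  by apply/orP; left.
have Yc : Y \in c.
  apply: maximal_chain_mem maxc _ _; first by rewrite itvE subxx andbT.
  move=> W /(subsetP cI); rewrite itvE => /andP[_ WY].
  by apply/orP; right.
have [eXY|nXY] := eqVneq X Y.
  exists [::]; first by rewrite eXY setDv enum_set0.
  apply/setP => Z; rewrite !inE; apply/idP/eqP => [|-> //].
  by move/(subsetP cI); rewrite itvE -eXY -eqEsubset => /eqP.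
have YcX : Y \in c :\ X by rewrite !inE eq_sym nXY.
have [Z /setD1P[nZX Zc] Zmin] :=
  @arg_minnP _ Y (mem (c :\ X)) (fun Z => #|Z|) YcX.
have subZ W : W \in c -> W != X -> Z \subset W.
  move=> Wc nWX; have /orP[//|sWZ] := chc _ _ Zc Wc.
  suff -> : W = Z by [].
  by apply/eqP; rewrite eqEcard (sWZ : W \subset Z); apply: Zmin; apply/setD1P.
have /andP[XZ ZY] : (X \subset Z) && (Z \subset Y).
  by rewrite -itvE; apply: (subsetP cI).
have /subsetPn[i iZ iX] : ~~ (Z \subset X).
  by apply: contra nZX => ZX; rewrite eqEsubset ZX.
have iXc : i |: X \in c.
  apply: maximal_chain_mem maxc _ _.
    by rewrite itvE subsetUr subUset sub1set XY (subsetP ZY).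
  move=> W Wc; have [->|/(subZ W Wc) ZW] := eqVneq W X.
    by apply/orP; right; apply: subsetUr.
  apply/orP; left; apply: subset_trans ZW.
  by rewrite subUset sub1set iZ.
have eZ : Z = i |: X.
  apply/eqP; rewrite eqEsubset subUset sub1set iZ XZ andbT subZ //.
  by apply: contraNneq iX => <-; rewrite setU11.
have iYX : i \in Y :\: X by rewrite inE iX (subsetP ZY).
have XnZ : ~~ (Z \subset X) by apply/subsetPn; exists i.
have [||s pe ec] := IHk Z (c :\ X) _ ZY.
- rewrite ltnS in ltk; apply: leq_trans ltk; apply: proper_card.
  rewrite properE setDS //=.
  by apply/subsetPn; exists i; rewrite // inE iZ.
- apply/maximal_chainP; split.
  + by move=> V W /setD1P[_ Vc] /setD1P[_ Wc]; apply: chc.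
  + apply/subsetP => W /setD1P[nWX Wc]; rewrite itvE subZ //=.
    by have := subsetP cI W Wc; rewrite itvE => /andP[].
  move=> c' chc' c'I scc'.
  have ZI W : W \in c' -> Z \subset W /\ W \subset Y.
    by move/(subsetP c'I); rewrite itvE => /andP[].
  have Xc' : X \notin c' by apply: contra XnZ => /ZI[].
  rewrite -(maxc' (X |: c')) ?setU1K //.
  + move=> V W /setU1P[->|Vc] /setU1P[->|Wc]; rewrite ?comparablexx //.
    * by apply/orP; left; apply: subset_trans XZ _; case: (ZI _ Wc).
    * by apply/orP; right; apply: subset_trans XZ _; case: (ZI _ Vc).
    * exact: chc'.
  + apply/subsetP => W /setU1P[->|/ZI[ZW WY]]; rewrite itvE ?subxx //.
    by rewrite (subset_trans XZ).
  + by rewrite -(setD1K Xc) setUS.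
exists (i :: s); first by rewrite perm_enum_setD1 // -eZ.
by rewrite flag_cons -eZ -(setD1K Xc) ec; apply/setP => W; rewrite !inE.
Qed.

Lemma sort_flag X Y s : perm_eq s (enum (Y :\: X)) ->
  sort <=%O (enum [set:: flag X s]) = flag X s.
Proof.
move=> pe; apply: le_sorted_eq.
- apply: (@sort_sorted_in _ (mem [set:: flag X s])); last first.
    by apply/allP => Z; rewrite mem_enum.
  exact: flag_chain pe.
- by apply: sub_sorted (flag_path pe) => Z W /ltW.
rewrite perm_sort; apply: uniq_perm; rewrite ?enum_uniq //.
  exact: lt_sorted_uniq (flag_path pe).
by move=> Z; rewrite mem_enum in_set.
Qed.

End Flags.

(** * Labels of chains and the EL property *)

Section Labels.

Variable n : nat.
Implicit Types (X Y Z : {set 'I_n}) (s t : seq 'I_n) (c : {set {set 'I_n}}).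

Lemma label_seq_flag X Y s : perm_eq s (enum (Y :\: X)) ->
  label_seq (@boolean_label n) [set:: flag X s] =
  [seq Posz i.+1 | i : 'I_n <- s].
Proof.
move=> pe; rewrite /label_seq (sort_flag pe) /=.
elim: s X pe => [//|i s IHs] X /perm_cons_setD[iX _ /IHs /= ->].
by rewrite boolean_labelE.
Qed.

Lemma label_inj : injective (fun i : 'I_n => Posz i.+1).
Proof. by move=> i j [] /val_inj. Qed.

Lemma sorted_label s :
  sorted <=%O [seq Posz i.+1 | i : 'I_n <- s] = sorted leq [seq val i | i <- s].
Proof. by rewrite !sorted_map. Qed.

Lemma sorted_enum_set X : sorted leq [seq val i | i <- enum X].
Proof.
rewrite sorted_map /(enum _) -enumT; apply: sorted_filter.
  by move=> i j k; apply: leq_trans.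
by have := iota_sorted 0 n; rewrite -val_enum_ord sorted_map.
Qed.

Lemma sorted_eq_enum X s : sorted leq [seq val i | i <- s] ->
  perm_eq s (enum X) -> s = enum X.
Proof.
move=> ss pe; apply: (inj_map val_inj).
apply: (sorted_eq leq_trans anti_leq) => //; first exact: sorted_enum_set.
exact: perm_map.
Qed.

(** An ascending label sequence lists the elements of Y minus X increasingly,
    and [enum] is that list: this is why the ascending chain is unique. *)
Lemma ascending_flag X Y s : perm_eq s (enum (Y :\: X)) ->
  ascending (@boolean_label n) [set:: flag X s] = (s == enum (Y :\: X)).
Proof.
move=> pe; rewrite /ascending (label_seq_flag pe) sorted_label.
apply/idP/eqP => [ss|->]; last exact: sorted_enum_set.
exact: sorted_eq_enum.
Qed.

Lemma unique_ascending_flag X Y : X \subset Y ->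
  unique_ascending (@boolean_label n) X Y [set:: flag X (enum (Y :\: X))].
Proof.
move=> XY; have pe := perm_refl (enum (Y :\: X)).
apply/and3P; split; first exact: flag_maximal.
  by rewrite (ascending_flag pe).
apply/forallP => c; apply/implyP => /andP[/(maximal_flag XY)[s pes ->]].
by rewrite (ascending_flag pes) => /eqP->.
Qed.

End Labels.

(** At the first place where they differ, a rearrangement has a larger entry
    than the sorted sequence, whose head is always the least entry left. *)
Lemma sorted_lexi_min (d : Order.disp_t) (T : orderType d) (s t : seq T) :
  sorted <=%O s -> perm_eq s t -> ((s : seqlexi T) <= (t : seqlexi T))%O.
Proof.
elim: s t => [|x s IHs] t ss pst; first by case: t pst => // y t /perm_size.
case: t pst => [/perm_size //|y t] pst.
rewrite lexi_cons; have xy : (x <= y)%O.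
  have : y \in x :: s by rewrite (perm_mem pst) mem_head.
  case/predU1P=> [->|ys] //.
  by have /allP := order_path_min le_trans ss; apply.
rewrite xy /=; apply/implyP => yx; apply: IHs; first exact: path_sorted ss.
have exy : x = y by apply/eqP; rewrite eq_le xy.
by move: pst; rewrite exy perm_cons.
Qed.

Lemma boolean_EL n : EL_labeling (@boolean_label n).
Proof.
move=> X Y ltXY; have XY : X \subset Y.
  by move: ltXY; rewrite lt_proper => /proper_sub.
exists [set:: flag X (enum (Y :\: X))]; first exact: unique_ascending_flag.
move=> c /(maximal_flag XY)[s pes ->] ns.
have pe := perm_refl (enum (Y :\: X)).
rewrite (label_seq_flag pe) (label_seq_flag pes) lt_neqAle.
rewrite sorted_lexi_min ?sorted_label ?sorted_enum_set ?andbT //.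
  apply: contraNneq ns => /(inj_map (@label_inj n)) es; first by rewrite -es.
by rewrite perm_map // perm_sym.
Qed.

(** * The weak order as the closure of ascent steps *)

Section WeakOrder.

Variable n : nat.
Implicit Types (u w : 'S_n) (k : 'I_n.-1).

Definition lpos k : 'I_n := widen_ord (leq_pred n) k.
Definition rpos k : 'I_n := Ordinal (succ_ord_subproof k).

Lemma lpos_lt_rpos k : (lpos k < rpos k)%N.
Proof. exact: ltnSn. Qed.

Lemma simple_reflE k : simple_refl k = tperm (lpos k) (rpos k).
Proof. by []. Qed.

Lemma simple_reflK k u : (simple_refl k * (simple_refl k * u))%g = u.
Proof. by rewrite mulgA simple_reflE tperm2 mul1g. Qed.

Lemma val_simple_refl k (i : 'I_n) : simple_refl k i =
  (if i == k :> nat then k.+1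
   else if i == k.+1 :> nat then k : nat else i) :> nat.
Proof.
rewrite simple_reflE; case: tpermP => [->|->|/eqP + /eqP]; rewrite -?val_eqE /=.
- by rewrite eqxx.
- by rewrite eqxx; case: eqP => //; lia.
- by move=> /negPf-> /negPf->.
Qed.

(** No value lies strictly between k and k + 1, so exchanging these two cannot
    affect their order relative to any third position. *)
Lemma simple_refl_lt k (i j : 'I_n) : (i < j)%N -> (i, j) != (lpos k, rpos k) ->
  (simple_refl k i < simple_refl k j)%N.
Proof.
rewrite xpair_eqE -!val_eqE /= !val_simple_refl => ij nij.
by do !case: eqP => ?; lia.
Qed.

(** Moving both positions of a pair by the transposition turns the inversions
    of u into those of the product, except for the pair of exchanged positions,
    which becomes an inversion. *)
Lemma inversions_ascent k u : (u (lpos k) < u (rpos k))%N ->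
  inversions (simple_refl k * u) = (inversions u).+1.
Proof.
move=> asc; pose f (p : 'I_n * 'I_n) := (simple_refl k p.1, simple_refl k p.2).
have finj : injective f by move=> [a b] [a' b'] [] /perm_inj-> /perm_inj->.
have fK p : f (f p) = p.
  by case: p => a b; rewrite /f simple_reflE /= !tpermK.
pose I w := [set p : 'I_n * 'I_n | (p.1 < p.2)%N && (w p.2 < w p.1)%N].
have fI : (lpos k, rpos k) \notin f @: I u.
  apply/imsetP => -[p pI ep].
  move: pI; rewrite inE -(fK p) -ep /f /= simple_reflE tpermL tpermR.
  by rewrite ltnNge ltnW // lpos_lt_rpos.
suff eI : I (simple_refl k * u)%g = (lpos k, rpos k) |: f @: I u.
  by rewrite /inversions -/(I _) eI cardsU1 fI (card_imset _ finj).
apply/setP => -[i j]; rewrite in_setU1; case: eqVneq => [[-> ->]|nij].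
  by rewrite inE /= !permM simple_reflE tpermL tpermR asc lpos_lt_rpos.
rewrite -[(i, j)]fK (mem_imset _ _ finj) fK !inE /= !permM.
have [ij|ji] := ltnP i j; first by rewrite (simple_refl_lt ij nij).
apply/esym/negbTE; rewrite negb_and -leqNgt; apply/orP.
have [/val_inj->|nji] := eqVneq (val i) (val j); first by left.
have ltji : (j < i)%N by rewrite ltn_neqAle eq_sym nji.
have [[ej ei]|/(simple_refl_lt ltji)/ltnW] := eqVneq (j, i) (lpos k, rpos k).
  right; rewrite ej ei simple_reflE tpermL tpermR -leqNgt.
  exact: ltnW.
by left.
Qed.

(** If u has a descent at k, then u is obtained from the product by an ascent,
    so the product has one inversion less than u. *)
Lemma inversions_ascentE k u :
  (inversions (simple_refl k * u) == (inversions u).+1) =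
  (u (lpos k) < u (rpos k))%N.
Proof.
have [asc|] := ltnP; first by rewrite inversions_ascent ?eqxx.
rewrite leq_eqVlt => /orP[/eqP/val_inj/perm_inj/(congr1 val)/=/eqP|desc].
  by rewrite eqn_leq ltnn.
have := @inversions_ascent k (simple_refl k * u)%g.
rewrite simple_reflK !permM simple_reflE tpermL tpermR => /(_ desc) ->.
by apply/eqP; lia.
Qed.

Definition ascent_step u w : bool :=
  [exists k, (u (lpos k) < u (rpos k))%N && (w == simple_refl k * u)%g].

(** The length condition on a word holds for every prefix exactly when each
    letter in turn raises the number of inversions by one, that is, acts at an
    ascent. *)
Lemma weak_leP u w : weak_le u w <-> connect ascent_step u w.
Proof.
split=> [[s -> ]|/connectP[p]].
  elim: s u => [//|k s IHs] u inv.
  have asc : (u (lpos k) < u (rpos k))%N.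
    by rewrite -inversions_ascentE -addn1 -(inv 1%N) //= take0.
  apply: (@connect_trans _ _ (simple_refl k * u)%g).
    by apply/connect1/existsP; exists k; rewrite asc eqxx.
  apply: IHs => j /andP[j0 js]; have := inv j.+1; rewrite /= => -> //.
  by rewrite inversions_ascent // addnS.
elim: p u => [|v p IHp] u /=; first by move=> _ ->; exists [::] => // -[].
case/andP=> /existsP[k /andP[asc /eqP ev]] /IHp{}IHp /IHp[s es inv].
exists (k :: s); first by rewrite /= -ev.
case=> // -[|j] js /=; first by rewrite take0 /= inversions_ascent // addn1.
by rewrite -ev inv // ev inversions_ascent // addSnnS.
Qed.

Lemma inversions_weak u w (s : seq 'I_n.-1) : w = mul_word u s ->
    (forall j, (0 < j <= size s)%N ->
       inversions (mul_word u (take j s)) = (inversions u + j)%N) ->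
  inversions w = (inversions u + size s)%N.
Proof.
case: s => [|k s ->]; first by rewrite addn0 => ->.
by move=> inv; rewrite -inv ?leqnn // take_size.
Qed.

(** Antisymmetry: each letter of a word witnessing [weak_le] adds an
    inversion, so two words going back and forth are both empty. *)
Lemma weak_le_partial_order : partial_order (@weak_le n).
Proof.
split=> [u|u w [s es invs] [t et invt]|u v w /weak_leP uv /weak_leP vw].
- exact/weak_leP/connect0.
- have /= := inversions_weak es invs; rewrite (inversions_weak et invt) => /eqP.
  rewrite -addnA -[X in X == _]addn0 eqn_add2l eq_sym addn_eq0.
  by case/andP=> _ /nilP s0; rewrite es s0.
- exact/weak_leP/(connect_trans uv).
Qed.

End WeakOrder.

(** * Permutations as maximal chains *)

Section PermutationChains.

Variable n : nat.
Implicit Types (u w : 'S_n) (k : 'I_n.-1) (i : 'I_n) (Z : {set 'I_n}).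

Definition word u : seq 'I_n := [seq u i | i <- enum 'I_n].

Lemma size_word u : size (word u) = n.
Proof. by rewrite size_map size_enum_ord. Qed.

Lemma perm_word u : perm_eq (word u) (enum (setT :\: set0 : {set 'I_n})).
Proof.
apply: uniq_perm; rewrite ?(map_inj_uniq (@perm_inj _ u)) ?enum_uniq //.
move=> x; rewrite mem_enum !inE; apply/mapP; exists ((u^-1)%g x).
  by rewrite mem_enum.
by rewrite permKV.
Qed.

(** For i : 'I_n the entry number i of s is [nth i s i]; the default is never
    used because s has size n, and taking i itself avoids having to exhibit an
    element of 'I_n, which may be empty. *)
Lemma word_of_perm (s : seq 'I_n) :
  perm_eq s (enum (setT :\: set0 : {set 'I_n})) -> exists u, s = word u.
Proof.
move=> pe; have us : uniq s by rewrite (perm_uniq pe) enum_uniq.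
have sz : size s = n by rewrite (perm_size pe) -cardE setD0 cardsT card_ord.
pose f i := nth i s i.
have finj : injective f.
  move=> i j; rewrite /f (set_nth_default i) ?sz // => /eqP.
  by rewrite nth_uniq ?sz // => /eqP/val_inj.
exists (perm finj); case: (posnP n) => [n0|n_gt0].
  have size_w : size (word (perm finj)) = 0%N by rewrite size_word n0.
  by rewrite (size0nil size_w); apply: size0nil; rewrite sz.
have x0 : 'I_n := Ordinal n_gt0.
apply: (@eq_from_nth _ x0) => [|i]; rewrite sz ?size_word // => lti.
rewrite (nth_map x0) ?size_enum_ord // permE /f nth_enum_ord //.
by apply: set_nth_default; rewrite sz.
Qed.

Definition perm_chain u : {set {set 'I_n}} := [set:: flag set0 (word u)].

Lemma itv0T : itv (set0 : {set 'I_n}) setT = setT.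
Proof. by apply/setP => Z; rewrite itvE sub0set subsetT inE. Qed.

Lemma chain_maximal u : maximal_chain [set: {set 'I_n}] (perm_chain u).
Proof. by rewrite -itv0T; apply: flag_maximal (sub0set _) (perm_word u). Qed.

Lemma maximal_chainE (c : {set {set 'I_n}}) :
  maximal_chain [set: {set 'I_n}] c -> exists u, c = perm_chain u.
Proof.
rewrite -itv0T => /(maximal_flag (sub0set _))[s /word_of_perm[u ->] ->].
by exists u.
Qed.

Lemma label_chain u : label_seq (@boolean_label n) (perm_chain u) = one_line u.
Proof. by rewrite (label_seq_flag (perm_word u)) -map_comp. Qed.

Lemma chain_inj : injective perm_chain.
Proof.
move=> u w /(congr1 (label_seq (@boolean_label n))).
rewrite !label_chain /one_line => /eq_in_map euw; apply/permP => i.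
by apply: label_inj; apply: euw; rewrite mem_enum.
Qed.

(** The set {u 0, ..., u (j - 1)}.  Stated through the inverse, so that
    membership is a comparison of positions. *)
Definition initial u (j : nat) : {set 'I_n} := [set x | (u^-1%g x < j)%N].

Lemma initialE u j : initial u j = [set:: take j (word u)].
Proof.
apply/setP => x; rewrite !inE -{2}[x](permKV u) -map_take.
rewrite mem_map; last exact: perm_inj.
rewrite -(mem_map val_inj) map_take val_enum_ord take_iota mem_iota /= add0n.
by rewrite leq_min ltn_ord andbT.
Qed.

Lemma chainP u Z :
  reflect (exists2 j, (j <= n)%N & Z = initial u j) (Z \in perm_chain u).
Proof.
rewrite in_set flagE size_word.
apply: (iffP mapP) => -[j]; rewrite ?mem_iota ?add0n => jn ->; exists j;
  by rewrite ?initialE ?set0U ?mem_iota.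
Qed.

Lemma card_initial u j : (j <= n)%N -> #|initial u j| = j.
Proof.
move=> jn; have := card_flag (perm_word u).
rewrite flagE size_word cards0 -map_comp.
rewrite -[in RHS](map_id (iota 0 n.+1)) => /eq_in_map/(_ j).
by rewrite mem_iota /= set0U -initialE => ->.
Qed.

(** A chain built from a permutation has one member of each cardinality, so
    membership of Z is an equation at rank #|Z|. *)
Lemma mem_chain u Z : (Z \in perm_chain u) = (Z == initial u #|Z|).
Proof.
apply/chainP/eqP => [[j jn ->]|->]; first by rewrite card_initial.
by exists #|Z| => //; rewrite -[leqRHS]card_ord max_card.
Qed.

Lemma initialS u i : initial u i.+1 = u i |: initial u i.
Proof.
apply/setP => x; rewrite !inE ltnS leq_eqVlt; congr (_ || _).
by rewrite -[in RHS](permKV u x) (inj_eq (@perm_inj _ u)).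
Qed.

Lemma initial_notin u i : u i \notin initial u i.
Proof. by rewrite inE permK ltnn. Qed.

Lemma initialS_inv u i j :
  j \notin initial u i -> initial u i.+1 = j |: initial u i -> j = u i.
Proof.
move=> jP; rewrite initialS => /setP/(_ j).
by rewrite !in_setU1 eqxx (negPf jP) orbF => /eqP.
Qed.

Lemma initial_sub u j l : (j <= l)%N -> initial u j \subset initial u l.
Proof. by move=> jl; apply/subsetP => x; rewrite !inE => /leq_trans; apply. Qed.

Lemma simple_refl_ltn k i j : j != k.+1 -> (simple_refl k i < j)%N = (i < j)%N.
Proof. by rewrite val_simple_refl; do !case: eqP => //; lia. Qed.

Lemma initial_simple_refl k u j : j != k.+1 ->
  initial (simple_refl k * u) j = initial u j.
Proof.
move=> jk; apply/setP => x; rewrite !inE invMg permM {1}simple_reflE tpermV.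
by rewrite -simple_reflE simple_refl_ltn.
Qed.

(** Let p send the position of a letter in w to its position in u.  Agreement
    of the initial sets of length j says that p preserves the first j
    positions.  If this holds for all j except k + 1, then p fixes every
    position apart from k and k + 1, and either fixes or exchanges those
    two. *)
Lemma initial_eq_simple_refl k u w :
    (forall j, (j <= n)%N -> j != k.+1 -> initial w j = initial u j) ->
  w = u \/ w = (simple_refl k * u)%g.
Proof.
move=> euw; pose p := (w * u^-1)%g.
have pE i j : (j <= n)%N -> j != k.+1 -> (p i < j)%N = (i < j)%N.
  move=> jn jk; have /setP/(_ (w i)) := euw j jn jk.
  by rewrite !inE permK permM => ->.
have pfix i : i != k :> nat -> i != k.+1 :> nat -> p i = i.
  move=> ik ik1; apply/val_inj/eqP => /=.
  rewrite eqn_leq -ltnS -[(i <= _)%N]negbK -ltnNge.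
  by rewrite !pE ?ltnn //; have := ltn_ord i; lia.
have := pE (lpos k) k.+2 (ltn_ord (rpos k)); have := pE (lpos k) k.
have := pE (rpos k) k.+2 (ltn_ord (rpos k)); have := pE (rpos k) k.
have ltkn : (k <= n)%N by have := ltn_ord (rpos k); rewrite /=; lia.
rewrite /= => /(_ ltkn) r0 r2 /(_ ltkn) l0 l2.
have nlr : p (lpos k) != p (rpos k) :> nat.
  by rewrite val_eqE (inj_eq (@perm_inj _ p)) -val_eqE /=; lia.
have -> : w = (p * u)%g by rewrite /p mulgKV.
have [pl|pl] := eqVneq (p (lpos k) : nat) k; [left|right].
  suff -> : p = 1%g by rewrite mul1g.
  apply/permP => i; rewrite perm1; apply: val_inj.
  have [ik|ik] := eqVneq (i : nat) k.
    by have -> : i = lpos k by apply: val_inj.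
  have [ik1|/pfix->//] := eqVneq (i : nat) k.+1.
  have -> /= : i = rpos k by apply: val_inj.
  lia.
congr (_ * u)%g; apply/permP => i; apply: val_inj.
rewrite [RHS](val_simple_refl k i).
have [ik|ik] := eqVneq (i : nat) k.
  have -> /= : i = lpos k by apply: val_inj.
  lia.
have [ik1|/pfix->//] := eqVneq (i : nat) k.+1.
have -> /= : i = rpos k by apply: val_inj.
lia.
Qed.

(** Multiplying by [simple_refl k] changes the chain at rank k + 1 only. *)
Lemma chain_simple_refl k u Z : #|Z| != k.+1 ->
  (Z \in perm_chain (simple_refl k * u)%g) = (Z \in perm_chain u).
Proof. by move=> Zk; rewrite !mem_chain initial_simple_refl. Qed.

Lemma chain_itv2 u (k : nat) : (k.+2 <= n)%N ->
  perm_chain u :&: itv (initial u k) (initial u k.+2) =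
  [set initial u k; initial u k.+1; initial u k.+2].
Proof.
move=> kn; have inu j : (j <= n)%N -> initial u j \in perm_chain u.
  by move=> jn; apply/chainP; exists j.
apply/setP => Z; rewrite inE itvE; apply/idP/idP.
  case/andP=> /chainP[j jn ->] /andP[/subset_leq_card + /subset_leq_card].
  rewrite !card_initial //; try by lia.
  rewrite leq_eqVlt => /predU1P[<-|kj]; first by rewrite !inE eqxx.
  rewrite leq_eqVlt => /predU1P[->|jk]; first by rewrite !inE eqxx !orbT.
  have -> : j = k.+1 by lia.
  by rewrite !inE eqxx orbT.
have kn1 := ltnW kn; have kn0 := ltnW kn1.
by case/setUP=> [/set2P[]|/set1P] ->; rewrite inu // !initial_sub //; lia.
Qed.

End PermutationChains.

(** * Polygon moves are ascent steps *)

Section Polygons.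

Variable n : nat.
Implicit Types (u w : 'S_n) (k : 'I_n.-1) (Z : {set 'I_n}).

Lemma initial_simple_reflS k u :
  initial (simple_refl k * u) k.+1 = u (rpos k) |: initial u k.
Proof.
have := initialS (simple_refl k * u)%g (lpos k); rewrite /= => ->.
rewrite initial_simple_refl; last by rewrite neq_ltn ltnSn.
by rewrite permM simple_reflE tpermL.
Qed.

(** Since x, y and z are linked by covers, z has rank two more than x, and the
    two chains agree in every rank except that of y.  So w is u or differs from
    u by the transposition at k = #|x|; the first is excluded because y is not
    in the chain of u, and the descent x, y, z of w is an ascent of u. *)
Lemma polygon_move_ascent u w :
  polygon_move (@boolean_label n) (perm_chain u) (perm_chain w) ->
  ascent_step u w.
Proof.
case/existsP=> x /existsP[z /and5P[_ /setIP[xu xw] /setIP[zu zw] /eqP eqbelow]].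
case/and3P=> /eqP eqabove /existsP[y /and3P[/eqP eitv + yu]] _.
case/and3P=> cxy cyz desc.
have yw : y \in perm_chain w.
  have : y \in perm_chain w :&: itv x z by rewrite eitv !inE eqxx orbT.
  by case/setIP.
have [i ix ey] := covers_setU1 cxy; have [j jy ez] := covers_setU1 cyz.
have cy : #|y| = #|x|.+1 by rewrite ey cardsU1 ix.
have cz : #|z| = #|x|.+2 by rewrite ez cardsU1 jy cy.
have zn : (#|z| <= n)%N by rewrite -[leqRHS]card_ord max_card.
have kn : (#|x| < n.-1)%N by lia.
pose k := Ordinal kn.
have := xw; have := zw; have := yw; rewrite !mem_chain => yw' zw' xw'.
have ex : x = initial w k := eqP xw'.
have eqpre l : (l <= n)%N -> l != k.+1 -> initial w l = initial u l.
  move=> ln lk; suff lu : initial w l \in perm_chain u.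
    by move: lu; rewrite mem_chain card_initial // => /eqP.
  have lw : initial w l \in perm_chain w by apply/chainP; exists l.
  have [lek|ltk] := leqP l k.
    have : initial w l \in below (perm_chain u) x.
      by rewrite eqbelow inE lw ex; apply: initial_sub.
    by rewrite inE => /andP[].
  have : initial w l \in above (perm_chain u) z.
    rewrite eqabove inE lw (eqP zw') cz; apply: initial_sub.
    by rewrite ltn_neqAle eq_sym lk.
  by rewrite inE => /andP[].
have [ewu|ew] := initial_eq_simple_refl eqpre; first by rewrite -ewu yw in yu.
apply/existsP; exists k; rewrite ew eqxx andbT.
have ey' : y = initial w k.+1 by rewrite -[k.+1]cy; apply/eqP.
have ez' : z = initial w k.+2 by rewrite -[k.+2]cz; apply/eqP.
have wk : i = w (lpos k) by apply: initialS_inv; rewrite /= -ex // -ey'.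
have wk1 : j = w (rpos k) by apply: initialS_inv; rewrite /= -ey' // -ez'.
move: desc; rewrite ez ey boolean_labelE // boolean_labelE -?ey // wk wk1 ew.
by rewrite !permM simple_reflE tpermL tpermR -ltNge.
Qed.

(** With x and z the members of rank k and k + 2 common to both chains, the
    interval [x, z] is a diamond with middle members x + u(k), on the chain of
    u, and x + u(k+1), on the chain of w.  As u(k) < u(k+1), the former is its
    ascending chain and the latter its descent. *)
Lemma ascent_polygon_move u w :
  ascent_step u w ->
  polygon_move (@boolean_label n) (perm_chain u) (perm_chain w).
Proof.
case/existsP=> k /andP[asc /eqP->{w}]; set w := (_ * u)%g.
have kn : (k.+2 <= n)%N := ltn_ord (rpos k).
have kn1 := ltnW kn; have kn0 := ltnW kn1.
pose x := initial u k; pose y := initial w k.+1; pose z := initial u k.+2.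
have wx : initial w k = x by apply: initial_simple_refl; lia.
have wz : initial w k.+2 = z by apply: initial_simple_refl; lia.
have ux : u (lpos k) \notin x := initial_notin u (lpos k).
have uy : initial u k.+1 = u (lpos k) |: x := initialS u (lpos k).
have ez : z = u (rpos k) |: (u (lpos k) |: x).
  by rewrite -uy; exact: (initialS u (rpos k)).
have ey : y = u (rpos k) |: x := initial_simple_reflS k u.
have nlr : u (lpos k) != u (rpos k) by rewrite -val_eqE /= neq_ltn asc.
have rx : u (rpos k) \notin x by rewrite inE permK -leqNgt leqnSn.
have ly : u (lpos k) \notin y by rewrite ey in_setU1 negb_or nlr.
have ez' : z = u (lpos k) |: y by rewrite ez ey setUCA.
have cx : #|x| = k by rewrite card_initial.
have cy : #|y| = k.+1 by rewrite card_initial.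
have cz : #|z| = k.+2 by rewrite card_initial.
have xz : x \subset z by apply: initial_sub; lia.
have inu j : (j <= n)%N -> initial u j \in perm_chain u.
  by move=> jn; apply/chainP; exists j.
apply/existsP; exists x; apply/existsP; exists z; apply/and5P; split.
- by rewrite lt_proper properEcard xz cx cz ltnW.
- by rewrite inE chain_simple_refl ?cx ?inu //; lia.
- by rewrite inE chain_simple_refl ?cz ?inu //; lia.
- apply/eqP/setP => Z; rewrite [LHS]in_set [RHS]in_set.
  apply: andb_id2r => /subset_leq_card.
  by rewrite cx => Zk; rewrite chain_simple_refl //; lia.
apply/and3P; split.
- apply/eqP/setP => Z; rewrite [LHS]in_set [RHS]in_set.
  apply: andb_id2r => /subset_leq_card.
  by rewrite cz => Zk; rewrite chain_simple_refl //; lia.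
- apply/existsP; exists y; apply/and3P; split.
  + by rewrite -wx -wz chain_itv2.
  + apply/and3P; split.
    * by rewrite ey; apply: covers_setU1r.
    * by rewrite ez'; apply: covers_setU1r.
    by rewrite ez' boolean_labelE // ey boolean_labelE // -ltNge.
  + rewrite mem_chain cy uy; apply: contraNneq ly => ->.
    exact: setU11.
have -> : perm_chain u :&: itv x z = [set:: flag x (enum (z :\: x))].
  rewrite chain_itv2 // -(@sorted_eq_enum _ _ [:: u (lpos k); u (rpos k)]).
  - by apply/setP => Z; rewrite !inE uy -ez orbA.
  - by rewrite /= andbT ltnW.
  have lzx : u (lpos k) \in z :\: x by rewrite in_setD ux ez' setU11.
  rewrite perm_enum_setD1 // perm_enum_setD1 -?ez ?setDv ?enum_set0 //.
  by rewrite ez in_setD !in_setU1 eqxx negb_or eq_sym nlr rx.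
exact: unique_ascending_flag.
Qed.

End Polygons.

(** * The isomorphism *)

Theorem theorem3p11 (n : nat) :
  EL_labeling (@boolean_label n) /\
  exists2 phi : maxchains {set 'I_n} -> 'S_n,
    (forall m : maxchains {set 'I_n},
        label_seq (@boolean_label n) (val m) = one_line (phi m)) &
    poset_isomorphism (mcd_le (@boolean_label n)) (@weak_le n) phi.
Proof.
split; first exact: boolean_EL.
pose psi (u : 'S_n) : maxchains {set 'I_n} :=
  exist _ (perm_chain u) (chain_maximal u).
have psi_surj (m : maxchains {set 'I_n}) : exists u, m == psi u.
  have [u em] := maximal_chainE (valP m).
  by exists u; apply/eqP/val_inj.
pose phi m := xchoose (psi_surj m).
have phiK m : psi (phi m) = m by apply/esym/eqP/(xchooseP (psi_surj m)).
have psiK u : phi (psi u) = u.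
  by apply: chain_inj; exact: (congr1 val (phiK (psi u))).
have le_phi m m' : mcd_le (@boolean_label n) m m' ->
    connect (@ascent_step n) (phi m) (phi m').
  case/connectP=> p; elim: p m => [|m1 p IHp] m /=.
    by move=> _ ->; apply: connect0.
  case/andP=> mm1 /IHp{}IHp /IHp; apply: connect_trans; apply: connect1.
  by apply: polygon_move_ascent; rewrite -{1}(phiK m) -{1}(phiK m1) in mm1.
have le_psi u w : connect (@ascent_step n) u w ->
    mcd_le (@boolean_label n) (psi u) (psi w).
  rewrite /mcd_le; case/connectP=> p; elim: p u => [|v p IHp] u /=.
    by move=> _ ->; apply: connect0.
  case/andP=> uv /IHp{}IHp /IHp; apply: connect_trans; apply: connect1.
  exact: ascent_polygon_move.
have phi_le m m' : mcd_le (@boolean_label n) m m' <-> weak_le (phi m) (phi m').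
  rewrite weak_leP; split=> [/le_phi //|].
  by move/le_psi; rewrite !phiK.
have [wrefl wanti wtrans] := weak_le_partial_order n.
exists phi.
  by move=> m; rewrite -label_chain -{1}(phiK m).
split=> //.
- split=> [m|m m'|m m' m''].
  + exact: connect0.
  + move=> /phi_le le1 /phi_le le2.
    by rewrite -(phiK m) -(phiK m') (wanti _ _ le1).
  + exact: connect_trans.
- by exists psi.
Qed.
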